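(* There are no simple anti-Leibniz algebras over $\mathbb{C}$.
   Context: An algebra means a complex vector space with a bilinear multiplication, not assumed associative. A (right) anti-Leibniz algebra is an algebra $L$ satisfying $(xy)z=-(xz)y-x(yz)$ for all $x,y,z\in L$. An algebra $L$ is simple if its multiplication is not identically zero and it has no two-sided ideals other than $0$ and $L$. *)

(* Defs.v *)
From HB Require Import structures.
From mathcomp Require Import all_boot all_order all_algebra.
From mathcomp Require Import classical_sets.

Set Implicit Arguments.
Unset Strict Implicit.
Unset Printing Implicit Defensive.

Import GRing.Theory.
Local Open Scope ring_scope.
Local Open Scope classical_set_scope.

(** An algebra over a field [K] is a [K]-module [L], of arbitrary dimension,
    together with a bilinear [mul : {bilinear L -> L -> L}]; neither
    associativity nor a unit is assumed. *)

Definition anti_leibniz (K : fieldType) (L : lmodType K)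
    (mul : {bilinear L -> L -> L}) : Prop :=
  forall x y z : L,
    mul (mul x y) z = - mul (mul x z) y - mul x (mul y z).

Definition linear_subspace (K : fieldType) (L : lmodType K) (I : set L) : Prop :=
  I 0 /\ (forall (a : K) (x y : L), I x -> I y -> I (a *: x + y)).

Definition two_sided_ideal (K : fieldType) (L : lmodType K)
    (mul : {bilinear L -> L -> L}) (I : set L) : Prop :=
  linear_subspace I /\ (forall x y : L, I y -> I (mul x y) /\ I (mul y x)).

Definition simple_algebra (K : fieldType) (L : lmodType K)
    (mul : {bilinear L -> L -> L}) : Prop :=
  (exists x y : L, mul x y != 0) /\
  (forall I : set L, two_sided_ideal mul I -> I = [set 0] \/ I = [set: L]).

(* Main.v *)
Require Import Defs.
From HB Require Import structures.
From mathcomp Require Import all_boot all_order all_algebra.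
From mathcomp Require Import boolp classical_sets zify.
From mathcomp Require Import complex.
From mathcomp Require Import reals.

Set Implicit Arguments.
Unset Strict Implicit.
Unset Printing Implicit Defensive.

Import GRing.Theory.
Local Open Scope ring_scope.
Local Open Scope complex_scope.

(** The identity reads x(yz) = - (xy)z - (xz)y, whose right-hand side is
    symmetric in y and z. So x(yz) = x(zy), and the right annihilator is an
    ideal containing all commutators.  In a simple algebra it is zero, and the
    algebra is commutative with
    (xy)z = - x(yz) - y(xz): a mock-Lie (or Jacobi-Jordan) algebra
    ([anti_leibniz_simple_mock_lie]).  In finite dimension such algebras are
    known to be nilpotent; here the dimension is arbitrary, and the point is a
    local nilpotency theorem.

    Write L_x for multiplication by x.  Then L_(xy) = - (L_x L_y + L_y L_x),
    and the sum of L_x L_y L_z over all orders of the three factors vanishes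
    ([sum_perm3_eq0]).  Call s a sandwich when s s = 0, so that L_s L_s = 0.
    A product of two sandwiches is a sandwich, and every square is a sandwich.

    The heart of the proof is [sandwich_nilpotent]: for every m there is an N
    such that any product of N multiplications by elements of a set of m
    sandwiches is zero.  It is a rewriting argument in the style of Shirshov.
    For the step from m to m + 1, number the sandwiches by 0, ..., m and
    consider the lexicographically smallest nonzero word of a given length.
    Since - L_(xy) = L_x L_y + L_y L_x, an iterated bracket acts as one leading word
    plus smaller words, exactly as for Lyndon words in a free Lie algebra; so
    in the minimal word a leading word may be replaced by the action of its
    bracket.  The symmetric identity in three variables forbids, in the minimal
    word, three adjacent leading words u > v > w whose order is the largest
    one.  Cut the word at the largest letter m into blocks m A, with A a word in
    smaller letters.  Taking triples (m A')(a)(b), one sees that A is strictly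
    increasing.  Choose a stretch of blocks that starts with the largest one,
    m A.  Taking triples in which the first word starts at that block and the
    last one is the final letter of a later block m B, one sees that
    B = A or B consists of the letters of A smaller than some c outside A,
    followed by c ([next_block]).  As A is nonempty, at most m different blocks
    occur; their brackets are sandwiches, and induction on m applies to them.

    In a simple mock-Lie algebra the sandwiches span.  Choose x and a sandwich s
    with xs <> 0.  The ideal generated by xs contains x, so x is a combination
    of elements L_(s1) ... L_(sk) x with k > 0 and finitely many sandwiches in
    total; iterating this, x is a combination of such elements with k as large
    as one likes, hence x = 0. *)

(** * Lexicographic order on words *)

(** A word and a proper prefix of it are not comparable: the words have to
    differ at a common position, which makes the order stable under arbitrary
    right extensions ([lexlt_catr]). *)
Fixpoint lexlt (u v : seq nat) : bool :=
  match u, v with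
  | a :: u', b :: v' => (a < b)%N || ((a == b) && lexlt u' v')
  | _, _ => false
  end.

Lemma lexlt_trans : transitive lexlt.
Proof.
move=> v u w; elim: u v w => [|a u IH] [|b v] [|c w] //=.
case/orP => [ab|/andP[/eqP-> uv]]; case/orP => [bc|/andP[/eqP<- vw]].
- by rewrite (ltn_trans ab bc).
- by rewrite ab.
- by rewrite bc.
- by rewrite eqxx (IH _ _ uv vw) orbT.
Qed.

Lemma lexlt_cat2l p u v : lexlt (p ++ u) (p ++ v) = lexlt u v.
Proof. by elim: p => //= a p ->; rewrite ltnn eqxx. Qed.

Lemma lexlt_catr u v a b : lexlt u v -> lexlt (u ++ a) (v ++ b).
Proof.
elim: u v => [|c u IH] [|d v] //= /orP[->//|/andP[-> /IH->]].
by rewrite orbT.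
Qed.

(** Words of a fixed length are well-founded even over an infinite alphabet. *)
Lemma lexlt_size_ind (P : seq nat -> Prop) n :
  (forall w, size w = n ->
     (forall w', size w' = n -> lexlt w' w -> P w') -> P w) ->
  forall w, size w = n -> P w.
Proof.
elim: n P => [|n IHn] P H; first by case=> // _; apply: H => // -[].
case=> // a w [sw]; elim/ltn_ind: a w sw => a IHa.
apply: (IHn (fun w => P (a :: w))) => w sw IHw.
apply: H => /=; first by rewrite sw.
case=> //= b w' [sw'] /orP[ba|/andP[/eqP-> w'w]]; first exact: IHa.
exact: IHw.
Qed.

(** * Blocks *)

(** A block is a word [A] in letters smaller than [m], standing for the factor
    [m :: A]. In a long word it is followed by the next [m], hence the final
    [m] here: a proper prefix of [A] is larger than [A]. *)
Definition block_lt m (A B : seq nat) := lexlt (rcons A m) (rcons B m).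

Lemma block_lt_total m A B : all (gtn m) A -> all (gtn m) B ->
  [|| A == B, block_lt m A B | block_lt m B A].
Proof.
rewrite /block_lt; elim: A B => [|a A IH] [|b B] //=.
- by move=> _ /andP[-> _]; rewrite orbT.
- by move=> /andP[-> _].
move=> /andP[am Am] /andP[bm Bm]; rewrite eqseq_cons.
case: (ltngtP a b) => //=; rewrite ?orbT //.
by move=> _; apply: IH.
Qed.

(** If deleting the last letter of a block smaller than [A] makes it no longer
    smaller, then only that last letter, or the length, separates the two. *)
Lemma block_lt_rcons m B c A : all (gtn m) A ->
  block_lt m (rcons B c) A -> ~~ block_lt m B A ->
  B = A \/ exists d A', A = B ++ d :: A' /\ (c < d)%N.
Proof.
rewrite /block_lt; elim: B A => [|b B IH] [|a A] //=; try by left.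
- case/andP=> am Am; case/orP=> [ca _|/andP[_ h] _].
    by right; exists a, A.
  by case: A Am h => [|a' A] /=; rewrite ?ltnn ?orbF ?andbF // => /andP[]; lia.
- by move=> _; case: (b < m)%N => //=; case: (rcons (rcons B c) m) => [|? ?];
    rewrite andbF.
case/andP=> am Am; case: (ltngtP b a) => //= ->.
move=> lt1 /(IH _ Am lt1) [->|[d [A' [-> cd]]]]; first by left.
by right; exists d, A'.
Qed.

Lemma unsorted_descent A : ~~ sorted ltn A ->
  exists A1 a b A2, A = A1 ++ a :: b :: A2 /\ (b <= a)%N.
Proof.
elim: A => // a [|b A] //= IH; rewrite negb_and -leqNgt.
case/orP => [ba|/IH[A1 [c [d [A2 [-> dc]]]]]]; first by exists [::], a, b, A.
by exists (a :: A1), c, d, A2.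
Qed.

Definition block_le m A B := (A == B) || block_lt m A B.

Lemma block_le_refl m : reflexive (block_le m).
Proof. by move=> A; rewrite /block_le eqxx. Qed.

Lemma block_le_trans m : transitive (block_le m).
Proof.
move=> B A C; rewrite /block_le => /orP[/eqP->//|AB] /orP[/eqP<-|BC].
  by rewrite AB orbT.
by rewrite /block_lt (lexlt_trans AB BC) orbT.
Qed.

Lemma block_le_total m : {in [pred A | all (gtn m) A] &, total (block_le m)}.
Proof.
move=> A B /= Am Bm; rewrite /block_le.
by case/or3P: (block_lt_total Am Bm) => ->; rewrite ?orbT.
Qed.

Lemma max_mem (T : eqType) (le : rel T) (s : seq T) :
  reflexive le -> transitive le -> {in s &, total le} -> s != [::] ->
  exists2 y, y \in s & all (le^~ y) s.
Proof.
move=> ler let_; elim: s => // x [|z s] IH tot _.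
  by exists x; rewrite ?inE //= ler.
have [|//|y ys sy] := IH.
  by move=> a b ha hb; apply: tot; rewrite in_cons ?ha ?hb orbT.
have [xy|yx] := orP (tot x y (mem_head _ _) (@mem_behead _ (x :: z :: s) _ ys)).
  by exists y; [rewrite in_cons ys orbT | apply/andP].
exists x; first exact: mem_head.
have xs : all (le^~ x) (z :: s).
  by apply/allP => a /(allP sy) ay; apply: let_ yx.
by apply/andP.
Qed.

(** Pigeonhole: the part of [s] before the first maximal element avoids one
    value, so if the maximal element comes too late to be followed by [r]
    entries, that part is still long enough for induction on the number of
    values. *)
Lemma max_window (T : eqType) (le : rel T) r (V s : seq T) :
  reflexive le -> transitive le -> {in V &, total le} ->
  {subset s <= V} -> (r * size V < size s)%N ->
  exists s1 y s2 s3,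
    [/\ s = s1 ++ y :: s2 ++ s3, size s2 = r & all (le^~ y) s2].
Proof.
move=> ler let_; have [n] := ubnP (size V).
elim: n V s => // n IHn V s Vn tot sV rVs.
have [||y ys sy] := max_mem ler let_ (s := s).
- by move=> a b /sV ha /sV hb; apply: tot.
- by apply: contraTneq rVs => ->; rewrite ltn0.
have yV := sV y ys.
have Es : s = take (index y s) s ++ y :: drop (index y s).+1 s.
  by rewrite -drop_index // cat_take_drop.
have yns1 : y \notin take (index y s) s by rewrite in_take // ltnn.
move: (take _ s) (drop _ s) Es yns1 => s1 s2 Es yns1.
have [rs2|s2r] := leqP r (size s2).
  exists s1, y, (take r s2), (drop r s2); rewrite cat_take_drop size_takel //.
  split=> //; apply/allP => a /mem_take as2; apply: (allP sy).
  by rewrite Es mem_cat in_cons as2 !orbT.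
pose V' := filter (predC1 y) V.
have V'lt : (size V' < size V)%N.
  by rewrite size_filter -(count_predC (pred1 y) V) addnC -{1}[count _ V]addn0
     ltn_add2l -has_count has_pred1.
have [||||t1 [z [t2 [t3 [Es1 st2 zt2]]]]] := IHn V' s1.
- by apply: leq_trans V'lt _; rewrite -ltnS.
- by move=> a b; rewrite !mem_filter => /andP[_ ha] /andP[_ hb]; apply: tot.
- move=> a as1; rewrite mem_filter /= sV ?Es ?mem_cat ?as1 // andbT.
  by apply: contraNneq yns1 => <-.
- move: rVs; rewrite Es size_cat /=; nia.
by exists t1, z, t2, (t3 ++ y :: s2); rewrite Es Es1 -!catA /= -!catA.
Qed.

(** * Mock-Lie algebras and sandwiches *)

Section MockLie.

Variables (K : fieldType) (L : lmodType K) (mul : {bilinear L -> L -> L}).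

Definition mock_lie :=
  (forall x y, mul x y = mul y x) /\
  (forall x y z, mul (mul x y) z = - mul x (mul y z) - mul y (mul x z)).

Hypotheses (K2 : 2%:R != 0 :> K) (K3 : 3%:R != 0 :> K).

Lemma double_eq0 (v : L) : v + v = 0 -> v = 0.
Proof.
move=> h; apply/eqP; have/eqP := h.
by rewrite -mulr2n -scaler_nat scaler_eq0 (negPf K2).
Qed.

Lemma triple_eq0 (v : L) : v + v + v = 0 -> v = 0.
Proof.
move=> h; apply/eqP; have/eqP := h.
by rewrite -mulr2n -mulrSr -scaler_nat scaler_eq0 (negPf K3).
Qed.

Hypothesis Hml : mock_lie.

Let mulC x y : mul x y = mul y x. Proof. exact: Hml.1. Qed.
Let mulA x y z : mul (mul x y) z = - mul x (mul y z) - mul y (mul x z).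
Proof. exact: Hml.2. Qed.

Lemma jordan_jacobi x y z :
  mul (mul x y) z + mul (mul y z) x + mul (mul z x) y = 0.
Proof.
rewrite mulA (mulC (mul y z) x) (mulC (mul z x) y) (mulC z x).
by rewrite addrAC subrK addNr.
Qed.

(** Apply to [e] the multiplication by the Jacobi sum of [x], [y], [z], expanded
    by the mock-Lie identity: each of the six orders appears twice. *)
Lemma sum_perm3_eq0 x y z e :
  mul x (mul y (mul z e)) + mul x (mul z (mul y e)) +
  (mul y (mul x (mul z e)) + mul y (mul z (mul x e))) +
  (mul z (mul x (mul y e)) + mul z (mul y (mul x e))) = 0.
Proof.
have E a b c : mul (mul (mul a b) c) e =
   (mul a (mul b (mul c e)) + mul b (mul a (mul c e))) +
   (mul c (mul a (mul b e)) + mul c (mul b (mul a e))).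
  by rewrite mulA !mulA linearBr linearNr !opprD !opprK.
apply: double_eq0; have := congr1 (mul^~ e) (jordan_jacobi x y z).
rewrite linear0l !linearDl !E => <-.
set a := mul x (mul y _); set b := mul x (mul z _).
set c := mul y (mul x _); set d := mul y (mul z _).
set f := mul z (mul x _); set g := mul z (mul y _).
by rewrite [LHS](AC (((2*2)*2)*((2*2)*2))
  (((1*3)*(5*6))*((4*12)*(7*2))*((11*8)*(10*9)))).
Qed.

Lemma mul_sqr_eq0 x : mul x (mul x x) = 0.
Proof.
by apply: triple_eq0; have := jordan_jacobi x x x; rewrite (mulC (mul x x)).
Qed.

Definition sandwich s := mul s s = 0.

Lemma sandwich_sqr x : sandwich (mul x x).
Proof. by rewrite /sandwich mulA mul_sqr_eq0 linear0r oppr0 addr0. Qed.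

Lemma sandwichN s : sandwich s -> sandwich (- s).
Proof. by rewrite /sandwich linearNl linearNr opprK. Qed.

Lemma sandwich_mul2 s e : sandwich s -> mul s (mul s e) = 0.
Proof.
move=> h; apply: double_eq0; apply: oppr_inj.
by rewrite opprD -mulA h linear0l oppr0.
Qed.

Lemma sandwichM s t : sandwich s -> sandwich t -> sandwich (mul s t).
Proof.
move=> hs ht; rewrite /sandwich mulA (sandwich_mul2 _ hs) (mulC s t).
by rewrite (sandwich_mul2 _ ht) !linear0r oppr0 addr0.
Qed.

(** * Leading words *)

Definition act (Bs : seq L) (e : L) := foldr mul e Bs.

Lemma act_cat s t e : act (s ++ t) e = act s (act t e).
Proof. exact: foldr_cat. Qed.

Lemma act0 s : act s 0 = 0.
Proof. by elim: s => //= x s ->; rewrite linear0r. Qed.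

Lemma actD s e f : act s (e + f) = act s e + act s f.
Proof. by elim: s => //= x s ->; rewrite linearDr. Qed.

Lemma actZ s c e : act s (c *: e) = c *: act s e.
Proof. by elim: s => //= x s ->; rewrite linearZr. Qed.

Section Words.

Variable g : nat -> L.

Definition word_act (w : seq nat) := act (map g w).

Lemma word_act_cat u v e : word_act (u ++ v) e = word_act u (word_act v e).
Proof. by rewrite /word_act map_cat act_cat. Qed.

(** The situation of a minimal nonzero word with prefix [a] and factor [u], the
    rest of the word being absorbed in [e]. *)
Definition below_vanish a u e :=
  forall u', size u' = size u -> lexlt u' u -> word_act (a ++ u') e = 0.

(** The product of the multiplications by the entries of [Bs] is the word [u]
    plus a combination of smaller words of the same length. The formulation by
    contexts keeps only the consequence that is needed and avoids talking about
    that combination. *)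
Definition lead Bs u := forall a e,
  below_vanish a u e -> word_act a (act Bs e) = word_act (a ++ u) e.

(** Likewise: [u] is a combination of smaller words of the same length. *)
Definition reducible u := forall a e,
  below_vanish a u e -> word_act (a ++ u) e = 0.

Lemma lead_nil : lead [::] [::].
Proof. by move=> a e _; rewrite cats0. Qed.

Lemma lead_letter i : lead [:: g i] [:: i].
Proof. by move=> a e _; rewrite word_act_cat. Qed.

Lemma below_vanish_l a u v e u' : below_vanish a (u ++ v) e ->
  size u' = size u -> lexlt u' u -> forall v', size v' = size v ->
  word_act (a ++ u') (word_act v' e) = 0.
Proof.
move=> h su lu v' sv; rewrite -word_act_cat -catA; apply: h.
  by rewrite !size_cat su sv.
exact: lexlt_catr.
Qed.

Lemma below_vanish_r a u v e : below_vanish a (u ++ v) e ->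
  below_vanish (a ++ u) v e.
Proof.
move=> h v' sv lv; rewrite -catA; apply: h; first by rewrite !size_cat sv.
by rewrite lexlt_cat2l.
Qed.

Lemma lead_cat Bs u Cs v : lead Bs u -> lead Cs v -> lead (Bs ++ Cs) (u ++ v).
Proof.
move=> hB hC a e h; rewrite act_cat hB; last first.
  move=> u' su lu; rewrite hC.
    by rewrite word_act_cat (below_vanish_l h su lu).
  move=> v' sv _; rewrite word_act_cat; exact: (below_vanish_l h su lu).
rewrite hC -?catA //; exact: below_vanish_r.
Qed.

Lemma lead_vanish Bs v w a e : lead Bs v -> size v = size w -> lexlt v w ->
  below_vanish a w e -> word_act a (act Bs e) = 0.
Proof.
move=> hB svw vw h; rewrite hB; first exact: h.
move=> v' sv' v'v; apply: h; first by rewrite sv'.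
exact: lexlt_trans vw.
Qed.

(** [- mul B C] acts as the anticommutator of the actions of [B] and [C]; of the
    two words [u ++ v] and [v ++ u] the larger one leads. *)
Lemma lead_bracket B u C v : lead [:: B] u -> lead [:: C] v ->
  lexlt (v ++ u) (u ++ v) -> lead [:: - mul B C] (u ++ v).
Proof.
move=> hB hC vu a e h; rewrite /= linearNl mulA -opprD opprK.
rewrite /word_act actD -!/(word_act _ _).
have := lead_cat hB hC h; have := lead_vanish (lead_cat hC hB) _ vu h.
rewrite /= => -> => [->|]; first by rewrite addr0.
by rewrite !size_cat addnC.
Qed.

Lemma reducible_of_lead Bs u :
  lead Bs u -> (forall e, act Bs e = 0) -> reducible u.
Proof. by move=> hB B0 a e /hB<-; rewrite B0 /word_act act0. Qed.

(** The vanishing sum over the six orders of [B], [C], [D] expresses its largest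
    word by the five others. *)
Lemma reducible_triple B u C v D w :
  lead [:: B] u -> lead [:: C] v -> lead [:: D] w ->
  lexlt (u ++ w ++ v) (u ++ v ++ w) -> lexlt (v ++ u ++ w) (u ++ v ++ w) ->
  lexlt (v ++ w ++ u) (u ++ v ++ w) -> lexlt (w ++ u ++ v) (u ++ v ++ w) ->
  lexlt (w ++ v ++ u) (u ++ v ++ w) -> reducible (u ++ v ++ w).
Proof.
move=> hB hC hD l1 l2 l3 l4 l5 a e h.
have := congr1 (word_act a) (sum_perm3_eq0 B C D e).
have V X p Y q Z r (hX : lead [:: X] p) (hY : lead [:: Y] q)
    (hZ : lead [:: Z] r) : size (p ++ q ++ r) = size (u ++ v ++ w) ->
    lexlt (p ++ q ++ r) (u ++ v ++ w) ->
    word_act a (mul X (mul Y (mul Z e))) = 0.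
  move=> ss ll.
  exact: (lead_vanish (lead_cat hX (lead_cat hY hZ)) ss ll h).
rewrite /word_act !actD act0 -!/(word_act _ _).
have <- := lead_cat hB (lead_cat hC hD) h.
rewrite (V _ _ _ _ _ _ hB hD hC) //; last by rewrite !size_cat; lia.
rewrite (V _ _ _ _ _ _ hC hB hD) //; last by rewrite !size_cat; lia.
rewrite (V _ _ _ _ _ _ hC hD hB) //; last by rewrite !size_cat; lia.
rewrite (V _ _ _ _ _ _ hD hB hC) //; last by rewrite !size_cat; lia.
rewrite (V _ _ _ _ _ _ hD hC hB) //; last by rewrite !size_cat; lia.
by rewrite !addr0.
Qed.

Lemma reducible_factor p u q : reducible u -> reducible (p ++ u ++ q).
Proof.
move=> hu a e h; rewrite !catA word_act_cat.
apply: hu => u' su lu; rewrite -word_act_cat -!catA; apply: h.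
  by rewrite !size_cat su.
by rewrite lexlt_cat2l; apply: lexlt_catr.
Qed.

(** Induction along the order: if every word reduces to smaller ones, a smallest
    nonzero word cannot exist. *)
Lemma reducible_all n : (forall w, size w = n -> reducible w) ->
  forall w e, size w = n -> word_act w e = 0.
Proof.
move=> h w e sw; move: w sw; apply: lexlt_size_ind => w sw IH.
apply: (h w sw [::]) => u' su lu; apply: IH => //; by rewrite su.
Qed.

Lemma reducible_factorl u q : reducible u -> reducible (u ++ q).
Proof. exact: (@reducible_factor [::]). Qed.

Lemma reducible_factorr p u : reducible u -> reducible (p ++ u).
Proof. by move/(@reducible_factor p u [::]); rewrite cats0. Qed.

(** * Reducible configurations of blocks *)

Definition left_bracket P w := foldl (fun Q i => - mul Q (g i)) P w.

(** The leading letter [m] exceeds all later ones, so each step of the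
    left-normed bracket satisfies the condition of [lead_bracket]. *)
Lemma lead_left_bracket m A :
  all (gtn m) A -> lead [:: left_bracket (g m) A] (m :: A).
Proof.
elim/last_ind: A => [|A c IH]; first by move=> _; exact: lead_letter.
rewrite all_rcons /= => /andP[cm Am].
rewrite /left_bracket foldl_rcons -cats1 -cat_cons.
by apply: lead_bracket; [exact: IH | exact: lead_letter | rewrite /= cm].
Qed.

Lemma sandwich_left_bracket P w : (forall i, sandwich (g i)) -> sandwich P ->
  sandwich (left_bracket P w).
Proof.
move=> hg; elim: w P => //= i w IH P hP.
by apply: IH; apply/sandwichN/sandwichM.
Qed.

Hypothesis hg : forall i, sandwich (g i).

Lemma reducible_square i : reducible [:: i; i].
Proof.
apply: (@reducible_of_lead ([:: g i] ++ [:: g i]) ([:: i] ++ [:: i])).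
  by apply: lead_cat; exact: lead_letter.
by move=> e; exact: sandwich_mul2.
Qed.

(** A descent [a > b] inside a block gives the decreasing triple formed by the
    part of the block before it, [a] and [b]; a repetition gives a square. *)
Lemma reducible_unsorted m A : all (gtn m) A -> ~~ sorted ltn A ->
  reducible (m :: A).
Proof.
move=> Am /unsorted_descent[A1 [a [b [A2 [EA ba]]]]]; move: Am.
rewrite EA all_cat /= => /and4P[A1m am bm _].
rewrite -cat_cons -[a :: b :: A2]/([:: a; b] ++ A2) catA.
apply: reducible_factorl; move: ba; rewrite leq_eqVlt => /orP[/eqP->|ba].
  apply: reducible_factorr; exact: reducible_square.
apply: (reducible_triple (u := m :: A1) (v := [:: a]) (w := [:: b])
  (lead_left_bracket A1m) (@lead_letter a) (@lead_letter b)).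
- by rewrite lexlt_cat2l /= ba.
- by rewrite /= am.
- by rewrite /= am.
- by rewrite /= bm.
- by rewrite /= bm.
Qed.

(** Here [p] is empty or starts with [m]: it stands for further blocks after
    the largest one, [m :: A]. *)
Lemma lexlt_block_rot m A p B X Y : head m p = m -> block_lt m B A ->
  lexlt ((m :: B) ++ m :: X) ((m :: A ++ p) ++ m :: Y).
Proof.
move=> hp BA; rewrite /= ltnn eqxx /=.
have [q Eq] : exists q, p ++ m :: Y = m :: q.
  by case: p hp => [_|a p /= ->]; [exists Y | exists (p ++ m :: Y)].
by rewrite -catA Eq -!cat_rcons; apply: lexlt_catr.
Qed.

(** Write [B] as [B'] followed by [c]. If [B'] is still smaller than [A], then
    the bracket [P], the block [m :: B'] and the letter [c] form a reducible
    triple. Otherwise [B'] is a prefix of [A], and as both blocks are increasing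
    [c] determines it: these are the letters of [A] below [c]. *)
Lemma next_block m A p P B : all (gtn m) A -> all (gtn m) B ->
  sorted ltn A -> sorted ltn B -> lead [:: P] (m :: A ++ p) ->
  head m p = m -> block_lt m B A ->
  reducible ((m :: A ++ p) ++ (m :: B)) \/
  exists2 c, (c < m)%N && (c \notin A) & B = rcons [seq a <- A | a < c]%N c.
Proof.
move=> Am Bm sA sB hP hp BA.
case/lastP: B Bm sB BA => [|B c] Bm sB BA.
  by case: A {sA hP} Am BA => [|a A] /=;
    rewrite /block_lt /= ?ltnn ?andbF //; lia.
move: Bm; rewrite all_rcons /= => /andP[cm Bm].
case: (boolP (block_lt m B A)) => [BA'|nBA].
  left; rewrite -rcons_cons -cats1.
  apply: (reducible_triple hP (lead_left_bracket Bm) (@lead_letter c)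
    (w := [:: c])).
  - by rewrite lexlt_cat2l /= cm.
  - by rewrite !catA lexlt_catr //; exact: lexlt_block_rot.
  - by rewrite catA cats1; exact: (lexlt_block_rot _ _ hp BA).
  - by rewrite /= cm.
  - by rewrite /= cm.
have Bc : all (gtn c) B.
  move: sB; rewrite -cats1 sorted_pairwise ?pairwise_cat; last exact: ltn_trans.
  by case/andP; rewrite allrel1r.
case: (block_lt_rcons Am BA nBA) => [EB|[d [A' [EA cd]]]];
  right; exists c; rewrite ?cm.
- by rewrite -EB; apply/negP => /(allP Bc); rewrite /= ltnn.
- by rewrite -EB; congr rcons; apply/esym/all_filterP.
- move: sA; rewrite EA sorted_pairwise; last exact: ltn_trans.
  rewrite pairwise_cat mem_cat inE /= => /and3P[_ _ /andP[dA' _]].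
  rewrite !negb_or; apply/and3P; split; last 2 first.
  + by rewrite neq_ltn cd.
  + by apply/negP => /(allP dA') /=; lia.
  by apply/negP => /(allP Bc); rewrite /= ltnn.
- move: sA; rewrite EA sorted_pairwise; last exact: ltn_trans.
  rewrite pairwise_cat /= => /and3P[_ _ /andP[dA' _]].
  congr rcons; rewrite filter_cat /= ltnNge (ltnW cd) /= (all_filterP Bc).
  rewrite (@eq_in_filter _ _ pred0) ?filter_pred0 ?cats0 // => x /(allP dA') /=.
  lia.
Qed.

Lemma lead_blocks m bs : all (all (gtn m)) bs ->
  lead [seq left_bracket (g m) B | B <- bs] (flatten [seq m :: B | B <- bs]).
Proof.
elim: bs => [|B bs IH] /=; first by move=> _; exact: lead_nil.
move=> /andP[Bm /IH bsl]; rewrite -cat1s -cat_cons.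
by apply: lead_cat; first exact: lead_left_bracket.
Qed.

(** The blocks that can occur after the largest block [A]. Each one besides [A]
    is coded by a letter outside [A], which is why they are fewer than the
    letters [0, ..., m] as soon as [A] is nonempty. *)
Definition next_blocks m A :=
  A :: [seq rcons [seq a <- A | a < c]%N c | c <- iota 0 m & c \notin A].

(** Reading the blocks from left to right, [P] is the bracket of the blocks
    read since the last occurrence of [A]. Each smaller block is absorbed into
    [P], which keeps [P] a bracket with leading word; a new [A] restarts it. *)
Lemma blocks_after_max m A p P bs :
  all (gtn m) A -> sorted ltn A -> lead [:: P] (m :: A ++ p) -> head m p = m ->
  all (all (gtn m)) bs -> all (sorted ltn) bs ->
  all (fun B => block_le m B A) bs ->
  reducible ((m :: A ++ p) ++ flatten [seq m :: B | B <- bs]) \/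
  {subset bs <= next_blocks m A}.
Proof.
move=> Am sA; elim: bs p P => [|B bs IH] p P hP hp; first by right.
move=> /= /andP[Bm bsm] /andP[sB sbs] /andP[/orP[/eqP EB|BA] bsA].
  have hA : lead [:: left_bracket (g m) A] (m :: A ++ [::]).
    by rewrite cats0; apply: lead_left_bracket.
  have [hr|hs] := IH [::] _ hA erefl bsm sbs bsA.
    left; rewrite cats0 in hr; rewrite EB -cat_cons; exact: reducible_factorr.
  by right=> C; rewrite !inE EB => /orP[->//|/hs]; rewrite inE.
have [hr|[c /andP[cm cA] EB]] := next_block Am Bm sA sB hP hp BA.
  left; have := @reducible_factorl _ (flatten [seq m :: C | C <- bs]) hr.
  by rewrite /= -!catA.
have hP' : lead [:: - mul P (left_bracket (g m) B)] (m :: A ++ (p ++ m :: B)).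
  rewrite catA -cat_cons; apply: lead_bracket (hP) (lead_left_bracket Bm) _.
  exact: lexlt_block_rot.
have hp' : head m (p ++ m :: B) = m by case: (p) hp.
have [hr|hs] := IH _ _ hP' hp' bsm sbs bsA.
  by left; move: hr; rewrite /= -!catA.
right=> C; rewrite inE => /orP[/eqP->|/hs//]; rewrite inE EB; apply/orP; right.
by apply: map_f; rewrite mem_filter cA mem_iota.
Qed.

Lemma size_next_blocks m A : all (gtn m) A -> A != [::] ->
  (size (next_blocks m A) <= m)%N.
Proof.
case: A => // a A /= /andP[am _] _; rewrite size_map size_filter.
rewrite -[X in (_ < X)%N](size_iota 0) -(count_predC (mem (a :: A)) (iota 0 m)).
rewrite -[X in (X < _)%N]add0n ltn_add2r -has_count; apply/hasP; exists a.
  by rewrite mem_iota.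
exact: mem_head.
Qed.

End Words.

(** * Local nilpotency for sandwiches *)

Lemma parse_blocks m w : all (geq m) w -> exists A0 bs,
  [/\ w = A0 ++ flatten [seq m :: B | B <- bs],
      all (gtn m) A0 & all (all (gtn m)) bs].
Proof.
elim: w => [|i w IH] /=; first by exists [::], [::].
move=> /andP[im /IH[A0 [bs [-> A0m bsm]]]]; move: im; rewrite leq_eqVlt.
case/orP => [/eqP->|im]; first by exists [::], (A0 :: bs); rewrite /= A0m.
by exists (i :: A0), bs; rewrite /= im.
Qed.

Lemma sorted_blocks_mask m A : all (gtn m) A -> sorted ltn A ->
  A \in [seq mask t (iota 0 m) | t : m.-tuple bool].
Proof.
move=> Am sA.
have /subseqP[t st ->] : subseq A (iota 0 m).
  apply/subseq_uniqP; first exact: iota_uniq.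
  apply: (irr_sorted_eq ltn_trans ltnn) => //.
    by apply: sorted_filter; [exact: ltn_trans | exact: iota_ltn_sorted].
  move=> i; rewrite mem_filter mem_iota add0n /=.
  by case: (boolP (i \in A)) => // /(allP Am).
rewrite size_iota in st; have tm : size t == m by apply/eqP.
by apply/mapP; exists (Tuple tm); rewrite ?mem_enum.
Qed.

Definition nilpotent_index m N := forall S : seq L, (size S <= m)%N ->
  {in S, forall s, sandwich s} ->
  forall v e, {subset v <= S} -> (N <= size v)%N -> act v e = 0.

(** The induction is on the number of sandwiches: the words of [r] consecutive
    blocks produced by [blocks_after_max] are products of multiplications by at
    most [m] sandwiches, the brackets of these blocks. There are at most [2 ^ m]
    strictly increasing blocks, which bounds the length needed to find such a
    stretch. *)
Lemma sandwich_nilpotent m : exists N, nilpotent_index m N.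
Proof.
elim: m => [|m [N IHN]].
  by exists 1%N => -[|//] _ _ [|x v] //= e /(_ x (mem_head _ _)).
(* One more than N, to have a block after the largest one also when N is 0. *)
set r := N.+1; exists (N + (r * 2 ^ m) * m.+1).+1 => S Sm hS v e vS.
set n := (_.+1) => nv.
(* Letters beyond the size of S denote 0, so words need no bound on letters. *)
pose g := nth 0 S.
have hg i : sandwich (g i).
  have [iS|iS] := ltnP i (size S); first by apply/hS/mem_nth.
  by rewrite /g nth_default // /sandwich linear0r.
have gred w : (forall e, act (map g w) e = 0) -> reducible g w.
  by move=> h a f _; rewrite word_act_cat {2}/word_act h /word_act act0.
suff red w : size w = n -> reducible g w.
  have Ev : v = map g (map (index^~ S) v).
    by rewrite -map_comp map_id_in // => x /vS xS; rewrite /= /g nth_index.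
  rewrite Ev -(cat_take_drop n (map _ v)) map_cat act_cat.
  by apply: (reducible_all red); rewrite size_takel // size_map.
move=> sw; case: (boolP (all (geq m) w)) => [wm|]; last first.
  rewrite -has_predC => /hasP[i iw im]; apply: gred => f.
  have gi : g i = 0.
    by rewrite /g nth_default // (leq_trans Sm) // ltnNge; exact: im.
  case/splitPr: iw => w1 w2; rewrite map_cat act_cat /= gi linear0l act0 //.
have [A0 [bs [Ew A0m bsm]]] := parse_blocks wm.
(* The letter m does not occur in A0, so the induction hypothesis applies. *)
have [NA0|A0N] := leqP N (size A0).
  rewrite Ew; apply: reducible_factorl; apply: gred => f.
  apply: (IHN (mkseq g m)); rewrite ?size_mkseq ?size_map //.
    by move=> s /mapP[i _ ->].
  by move=> s /mapP[i /(allP A0m) /= im ->]; apply: map_f; rewrite mem_iota.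
rewrite Ew; apply: reducible_factorr.
case: (boolP (all (sorted ltn) bs)) => [bss|]; last first.
  rewrite -has_predC => /hasP[B Bbs /= Bns].
  have Bm := allP bsm _ Bbs; case/splitPr: Bbs => b1 b2.
  rewrite map_cat flatten_cat /=; apply: reducible_factorr.
  rewrite -cat_cons; apply: reducible_factorl; exact: reducible_unsorted.
pose V := [seq mask t (iota 0 m) | t : m.-tuple bool].
have sV : size V = (2 ^ m)%N by rewrite size_map -cardE card_tuple card_bool.
have bsV : {subset bs <= V}.
  move=> B Bbs; apply: sorted_blocks_mask; first exact: (allP bsm).
  exact: (allP bss).
have Vm A : A \in V -> all (gtn m) A.
  move=> /mapP[t _ ->]; apply/allP => i /mem_mask; by rewrite mem_iota.
have [||s1 [A [s2 [s3 [Ebs s2r s2A]]]]] :=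
    max_window (r := r) (@block_le_refl m) (@block_le_trans m) _ bsV.
- by move=> A B /Vm Am /Vm Bm; apply: block_le_total.
- rewrite sV ltnNge; apply/negP => bsr.
  have : (size (flatten [seq m :: B | B <- bs]) <= size bs * m.+1)%N.
    rewrite size_flatten /shape -map_comp sumnE big_map.
    rewrite -sum1_size big_distrl /= big_seq [X in (_ <= X)%N]big_seq.
    apply: leq_sum => B /bsV /mapP[t _ ->] /=; rewrite mul1n ltnS.
    by rewrite (leq_trans (size_subseq (mask_subseq _ _))) ?size_iota.
  have := leq_mul bsr (leqnn m.+1); move: sw; rewrite Ew size_cat /n.
  by move: (size bs * m.+1)%N (r * 2 ^ m * m.+1)%N => a b; lia.
move: bsm bss; rewrite Ebs !all_cat /= !all_cat.
move=> /and4P[_ Am s2m _] /and4P[_ sA ss2 _].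
rewrite map_cat flatten_cat; apply: reducible_factorr.
rewrite map_cons map_cat /= flatten_cat catA.
rewrite -cat_cons; apply: reducible_factorl.
have hA : lead g [:: left_bracket g (g m) A] (m :: A ++ [::]).
  by rewrite cats0; apply: lead_left_bracket.
have [] := blocks_after_max Am sA hA erefl s2m ss2 s2A.
  by rewrite cats0.
(* If A is empty the stretch starts with a square. *)
move=> s2n; rewrite -cat_cons; have [A0'|An0] := eqVneq A [::].
  case: s2 s2r {s2A s2m ss2 s2n Ebs} => // B s2 _; rewrite A0' /=.
  have h : reducible g [:: m; m] by exact: reducible_square.
  exact: (reducible_factorl h).
apply: reducible_factorr.
apply: (reducible_of_lead (lead_blocks (g := g) s2m)) => f.
apply: (IHN [seq left_bracket g (g m) B | B <- next_blocks m A]).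
- by rewrite size_map; apply: size_next_blocks.
- by move=> s /mapP[B _ ->]; apply: sandwich_left_bracket.
- by move=> s /mapP[B /s2n Bn ->]; apply: map_f.
- by rewrite size_map s2r.
Qed.

(** * Simple algebras *)

Inductive lspan (X : L -> Prop) : L -> Prop :=
  | lspan0 : lspan X 0
  | lspan_scaleD c x y : X x -> lspan X y -> lspan X (c *: x + y).

Lemma lspan_lin X a x y : lspan X x -> lspan X y -> lspan X (a *: x + y).
Proof.
move=> hx hy; elim: hx => [|c u v Xu _ IH]; first by rewrite scaler0 add0r.
by rewrite scalerDr scalerA -addrA; apply: lspan_scaleD.
Qed.

Lemma lspan_gen (X : L -> Prop) x : X x -> lspan X x.
Proof.
by move=> Xx; rewrite -[x]addr0 -[x]scale1r; apply/lspan_scaleD/lspan0.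
Qed.

Lemma lspan_map (X Y : L -> Prop) (f : L -> L) : f 0 = 0 ->
  (forall a x y, f (a *: x + y) = a *: f x + f y) ->
  (forall x, X x -> lspan Y (f x)) -> forall x, lspan X x -> lspan Y (f x).
Proof.
move=> f0 fl XY x; elim=> [|c u v Xu _ IH]; first by rewrite f0; exact: lspan0.
by rewrite fl; apply: lspan_lin => //; apply: XY.
Qed.

Lemma lspan_sub (X Y : L -> Prop) :
  (forall x, X x -> lspan Y x) -> forall x, lspan X x -> lspan Y x.
Proof. by move=> XY x; apply: (lspan_map (f := id)). Qed.

Lemma lspan_mul (X Y : L -> Prop) z :
  (forall x, X x -> lspan Y (mul z x)) ->
  forall x, lspan X x -> lspan Y (mul z x).
Proof.
move=> h; apply: (lspan_map (f := mul z)) h => [|a x y].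
  by rewrite linear0r.
by rewrite linearDr linearZr.
Qed.

Lemma lspan_act (X Y : L -> Prop) v :
  (forall x, X x -> lspan Y (act v x)) ->
  forall x, lspan X x -> lspan Y (act v x).
Proof.
move=> h; apply: (lspan_map (f := act v)) h => [|a x y]; first exact: act0.
by rewrite actD actZ.
Qed.

Lemma lspan_ideal (X : L -> Prop) :
  (forall z x, X x -> lspan X (mul z x)) -> two_sided_ideal mul (lspan X).
Proof.
move=> h; split; first by split=> [|a x y]; [exact: lspan0 | exact: lspan_lin].
by move=> x y Xy; rewrite (mulC y x); split; apply: lspan_mul (h x) _ Xy.
Qed.

Hypothesis Hsimple : simple_algebra mul.

Lemma lspan_simple (X : L -> Prop) x0 :
  (forall z x, X x -> lspan X (mul z x)) -> X x0 -> x0 != 0 ->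
  forall x, lspan X x.
Proof.
move=> hX Xx0 nx0 x.
case: (Hsimple.2 _ (lspan_ideal hX)) => E; last by rewrite E.
by have := lspan_gen Xx0; rewrite E /= => x00; rewrite x00 eqxx in nx0.
Qed.

(** Products span an ideal, and by polarization every product is a combination
    of squares. *)
Lemma lspan_sandwich x : lspan sandwich x.
Proof.
have [a [b ab]] := Hsimple.1.
pose X z := exists x y, z = mul x y.
apply: (lspan_sub (X := X)); last first.
  apply: (lspan_simple (x0 := mul a b)) => //; last by exists a, b.
  by move=> z u _; apply: lspan_gen; exists z, u.
move=> _ [u [v ->]].
have -> : mul u v = 2%:R^-1 *: mul (u + v) (u + v)
    + (- 2%:R^-1 *: mul u u + (- 2%:R^-1 *: mul v v + 0)).
  apply: (scalerI K2); rewrite addr0 !scaleNr !scalerDr !scalerN !scalerA.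
  rewrite mulfV ?K2 // !scale1r scaler_nat mulr2n linearDl !linearDr.
  rewrite (mulC v u) [RHS](AC ((2*2)*2) ((2*3)*((1*5)*(4*6)))) /=.
  by rewrite !subrr !addr0.
by do 3!(apply: lspan_scaleD; first exact: sandwich_sqr); exact: lspan0.
Qed.

Lemma mul_sandwich_neq0 : exists x s, sandwich s /\ mul x s != 0.
Proof.
have [a [b ab]] := Hsimple.1.
apply: contrapT => h; have : lspan (fun z => z = 0) (mul a b).
  apply: (lspan_mul (X := sandwich)); last exact: lspan_sandwich.
  move=> s hs; have -> : mul a s = 0; last exact: lspan0.
  by apply: contrapT => /eqP n0; apply: h; exists a, s.
suff H z : lspan (fun z => z = 0) z -> z = 0 by move/H/eqP; rewrite (negPf ab).
by elim=> // c x y -> _ ->; rewrite scaler0 addr0.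
Qed.

(** The ideal generated by [mul x s] contains [x], and [mul x s] is itself the
    image of [x] under multiplication by [s]. So [x] is a combination of images
    of itself under nonempty words in finitely many sandwiches. *)
Lemma mock_lie_not_simple : False.
Proof.
have [x [s [hs xs]]] := mul_sandwich_neq0.
pose X z := exists2 v : seq L,
  {in v, forall t, sandwich t} & z = act v (mul x s).
have : lspan X x.
  apply: (lspan_simple (x0 := mul x s)) => //; last by exists [::].
  move=> z _ [v hv ->]; rewrite mulC.
  apply: (lspan_mul (X := sandwich)); last exact: lspan_sandwich.
  move=> t ht; rewrite mulC; apply: lspan_gen; exists (t :: v) => //.
  by move=> u; rewrite inE => /orP[/eqP->|/hv].
pose Y (S : seq L) n z := exists2 v : seq L,
  {subset v <= S} /\ (n <= size v)%N & z = act v x.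
(* Only finitely many sandwiches occur in one linear combination. *)
have fin z : lspan X z -> exists2 S : seq L, {in S, forall t, sandwich t} &
    lspan (Y S 1%N) z.
  elim=> [|c u z' [v hv ->] _ [S hS IH]].
    by exists [::]; last exact: lspan0.
  exists (rcons v s ++ S).
    move=> t; rewrite mem_cat mem_rcons inE -orbA.
    by case/or3P => [/eqP->|/hv|/hS].
  apply: lspan_scaleD.
    exists (rcons v s); last by rewrite -cats1 act_cat /= mulC.
    by split=> [t tv|]; rewrite ?mem_cat ?tv ?size_rcons.
  apply: lspan_sub IH => _ [w [wS w1] ->]; apply: lspan_gen; exists w => //.
  by split=> // t /wS tS; rewrite mem_cat tS orbT.
case/fin => S hS xS {fin}; have [N hN] := sandwich_nilpotent (size S).
(* Substitute the expression of x for x in itself, again and again. *)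
have xn n : lspan (Y S n) x.
  elim: n => [|n IH]; first by apply: lspan_gen; exists [::].
  apply: lspan_sub IH => _ [v [vS nv] ->]; apply: lspan_act xS.
  move=> _ [w [wS w1] ->]; apply: lspan_gen.
  exists (v ++ w); last by rewrite act_cat.
  split; first by move=> t; rewrite mem_cat => /orP[/vS|/wS].
  by rewrite size_cat -addn1 leq_add.
suff x0 : x = 0 by rewrite x0 linear0l eqxx in xs.
elim: (xn N) => // c _ y [v [vS Nv] ->] _ ->.
by rewrite (hN S (leqnn _) hS _ _ vS Nv) scaler0 addr0.
Qed.

End MockLie.

(** As x(yz) = - (xy)z - (xz)y is symmetric in y and z, commutators lie in the
    right annihilator; the same symmetry makes it a two-sided ideal. *)
Lemma anti_leibniz_simple_mock_lie (K : fieldType) (L : lmodType K)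
    (mul : {bilinear L -> L -> L}) :
  anti_leibniz mul -> simple_algebra mul -> mock_lie mul.
Proof.
move=> al [[a [b ab]] ideals].
have mulCr x y z : mul x (mul y z) = mul x (mul z y).
  have h u v : mul x (mul u v) = - mul (mul x v) u - mul (mul x u) v.
    by rewrite (al x u v) opprB addrC subrK.
  by rewrite !h addrC.
have ideal_ann : two_sided_ideal mul [set a | forall x, mul x a = 0]%classic.
  split; first split=> [x|c u v /= hu hv x]; first exact: linear0r.
    by rewrite linearDr linearZr /= hu hv scaler0 addr0.
  by move=> x y /= hy; split=> z; last rewrite mulCr; rewrite hy linear0r.
have mulC x y : mul x y = mul y x.
  case: (ideals _ ideal_ann) => E.
    have : [set a | forall x, mul x a = 0]%classic (mul x y - mul y x).
      by move=> z /=; rewrite linearBr (mulCr z x y) subrr.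
    by rewrite E /= => /eqP; rewrite subr_eq0 => /eqP.
  have : [set a | forall x, mul x a = 0]%classic b by rewrite E.
  by move=> /= /(_ a) ab0; rewrite ab0 eqxx in ab.
split=> // x y z; rewrite al (mulC (mul x z)); exact: addrC.
Qed.

Theorem theorem11 (R : realType) (L : lmodType R[i])
    (mul : {bilinear L -> L -> L}) :
  anti_leibniz mul -> ~ simple_algebra mul.
Proof.
move=> al simple.
apply: (mock_lie_not_simple _ _ _ simple); rewrite ?Num.Theory.pnatr_eq0 //.
exact: anti_leibniz_simple_mock_lie.
Qed.
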